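(* For each knot component $K_i$ of an (oriented or unoriented) link diagram $D=K_1\cup K_2\cup\dots\cup K_r$, the OU number $\Phi(K_i)$ is invariant under Reidemeister moves except for R$\mathrm{III}\alpha$ moves. That is, if $D'=K'_1\cup\dots\cup K'_r$ is obtained from $D$ by a single Reidemeister move (of type RI, RII or RIII) that is not an R$\mathrm{III}\alpha$ move, where $K'_i$ is the component corresponding to $K_i$, then $\Phi(K'_i)=\Phi(K_i)$ for every $i$.
   Context: An $r$-component link is an embedding of $r$ circles in $S^3$ or $\mathbb{R}^3$. A diagram $D=K_1\cup\dots\cup K_r$ of a link $k_1\cup\dots\cup k_r$ is a regular projection onto $S^2$ or $\mathbb{R}^2$ (with $K_i$ the image of $k_i$) whose intersections are transverse double points with over/under information. RI, RII, RIII denote the usual three types of Reidemeister moves. A crossing is non-self if its two strands belong to different components. For an oriented diagram, the non-self OU sequence $f(K_i)$ is the cyclic sequence obtained by traversing $K_i$ once along its orientation and recording, only at the non-self crossings encountered, $O$ when passing over and $U$ when passing under. It is empty if $K_i$ has no non-self crossings. Its length is always even. For a non-cyclic sequence $S=X_1X_2\cdots X_m$ with $X_i\in\{O,U\}$, put $\varepsilon(X_i)=+1$ if ($X_i=O$ and $i$ even) or ($X_i=U$ and $i$ odd), and $\varepsilon(X_i)=-1$ otherwise; $\Phi(S)=\frac12\sum_{i=1}^m\varepsilon(X_i)$. For a cyclic sequence $w$ of even length, $\Phi(w)=|\Phi(S)|$, where $S$ is any non-cyclic sequence obtained by cutting $w$ open (this is independent of the cut). The OU number of $K_i$ is $\Phi(K_i)=\Phi(f(K_i))$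 (so $\Phi(K_i)=0$ if $f(K_i)$ is empty). It does not depend on the orientations, so it is also defined for unoriented diagrams. The three segments in an RIII move are: the upper segment (over the other two), the middle segment (under the upper and over the lower), and the lower segment (under the other two). An RIII move is an R$\mathrm{III}\alpha$ move if the upper and middle segments belong to different components and the middle and lower segments belong to different components (the upper and lower segments may belong to the same or different components). *)

(* Defs.v *)
From mathcomp Require Import all_boot all_order all_algebra all_fingroup.
From mathcomp Require Import finmap.
From mathcomp Require Import all_classical all_reals all_analysis.

Set Implicit Arguments.
Unset Strict Implicit.
Unset Printing Implicit Defensive.

Import Order.TTheory GRing.Theory Num.Theory.
Import numFieldNormedType.Exports.

Local Open Scope classical_set_scope.
Local Open Scope ring_scope.

(** * Over/under sequences *)

Variant letter := Over | Under.

(* [eps i X] is the sign of the letter [X] in position [i]; positions are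
   counted from 1. *)
Definition eps (i : nat) (X : letter) : int :=
  match X with
  | Over => if odd i then -1 else 1
  | Under => if odd i then 1 else -1
  end.

Definition Phi_seq (S : seq letter) : rat :=
  (\sum_(i < size S) eps i.+1 (nth Over S i))%:~R / 2.

(* A cyclic sequence is represented by any of the sequences obtained by cutting
   it open.  Phi is only meaningful for cyclic sequences of even length, where
   it does not depend on the cut (lemma [Phi_cyclic_rot]); 0 is a dummy value
   outside of that domain. *)
Definition Phi_cyclic (S : seq letter) : rat :=
  if odd (size S) then 0 else `|Phi_seq S|.

Lemma epsS i X : eps i.+1 X = - eps i X.
Proof. by case: X => /=; case: (odd i); rewrite ?opprK. Qed.

Lemma Phi_cyclic_rot k S : Phi_cyclic (rot k S) = Phi_cyclic S.
Proof.
have rot1E (s : seq letter) : Phi_cyclic (rot 1 s) = Phi_cyclic s.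
  case: s => [//|x s]; rewrite rot1_cons /Phi_cyclic size_rcons /=.
  case: ifP => // /negbFE odd_s; rewrite /Phi_seq size_rcons /=.
  rewrite big_ord_recr big_ord_recl /= nth_rcons ltnn eqxx.
  have -> : eps (size s).+1 x = - eps 1 x by rewrite epsS; case: x; rewrite /= odd_s.
  have -> : \sum_(i < size s) eps i.+1 (nth Over (rcons s x) i)
    = - \sum_(i < size s) eps (bump 0 i).+1 (nth Over s i).
    rewrite -sumrN; apply: eq_bigr => i _.
    by rewrite nth_rcons ltn_ord /bump add1n [in RHS]epsS opprK.
  by rewrite -opprD addrC mulrNz mulNr normrN.
have [le_k|lt_k] := leqP k (size S); last by rewrite rot_oversize // ltnW.
by elim: k le_k => [|k IHk] lt_k; rewrite ?rot0 // rotS // rot1E IHk // ltnW.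
Qed.

(** * Link diagrams *)

Variant surface := Plane | Sphere.

Section Diagrams.
Variable R : realType.

Definition surface_set (X : surface) : set (R * R * R) :=
  match X with
  | Plane => [set p | p.2 = 0]
  | Sphere => [set p | p.1.1 ^+ 2 + p.1.2 ^+ 2 + p.2 ^+ 2 = 1]
  end.

Definition square : set (R * R) := [set p | `|p.1| <= 1 /\ `|p.2| <= 1].

Definition square_boundary : set (R * R) :=
  [set p | square p /\ (`|p.1| = 1 \/ `|p.2| = 1)].

(* Closed disks in the surface, with a parametrization by the square.  Such a
   map is a homeomorphism onto its image, and by invariance of domain it is open
   in the interior of the square. *)
Definition disk_embedding (X : surface) (e : R * R -> R * R * R) : Prop :=
  [/\ {within square, continuous e}, set_inj square e
    & e @` square `<=` surface_set X].

(* A point of the disjoint union of the r circles R/Z is a pair of an index of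
   component and a real parameter; parameters count modulo integers. *)
Definition same_point r (p q : 'I_r * R) : Prop :=
  p.1 = q.1 /\ exists z : int, q.2 = p.2 + z%:~R.

Definition meets r (K : 'I_r -> R -> R * R * R) (p q : 'I_r * R) : Prop :=
  K p.1 p.2 = K q.1 q.2 /\ ~ same_point p q.

(* Transversality is the topological one: some chart sends the two strands to
   the two coordinate axes.  As an arbitrary homeomorphism is allowed for the
   chart, it can absorb any reparametrization of the strands, so that asking for
   an affine parametrization of the axes is no restriction; smooth or
   piecewise linear transverse double points are instances. *)
Definition transverse_at X r (K : 'I_r -> R -> R * R * R) (p q : 'I_r * R) :=
  exists2 e, disk_embedding X e & exists2 d : R, 0 < d &
    forall x : R, `|x| <= 1 ->
      K p.1 (p.2 + d * x) = e (x, 0) /\ K q.1 (q.2 + d * x) = e (0, x).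

(* The value [over i t] is only meaningful if [curve i t] is a double point; it
   tells whether the strand at parameter [t] is the upper one there. *)
Record diagram (X : surface) (r : nat) := Diagram {
  curve : 'I_r -> R -> R * R * R;
  over : 'I_r -> R -> bool;
  curve_surface : forall i t, surface_set X (curve i t);
  curve_continuous : forall i, continuous (curve i);
  curve_periodic : forall i t, curve i (t + 1) = curve i t;
  over_periodic : forall i t, over i (t + 1) = over i t;
  finite_crossings : forall i,
    finite_set [set t | 0 <= t < 1 /\ exists q, meets curve (i, t) q];
  double_points : forall p q q',
    meets curve p q -> meets curve p q' -> same_point q q';
  transverse_crossings : forall p q,
    meets curve p q -> transverse_at X curve p q;
  over_under : forall p q,
    meets curve p q -> over p.1 p.2 = ~~ over q.1 q.2 }.

(** * The OU number *)

Definition nonself_params X r (D : diagram X r) (i : 'I_r) : set R :=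
  [set t | 0 <= t < 1 /\ exists j s, j <> i /\ curve D i t = curve D j s].

(* The cyclic sequence f(K_i), cut open at the parameter 0. *)
Definition nonself_OU_seq X r (D : diagram X r) (i : 'I_r) : seq letter :=
  [seq if over D i t then Over else Under
    | t <- sort <=%R (enum_fset (fset_set (nonself_params D i)))].

Definition OU_number X r (D : diagram X r) (i : 'I_r) : rat :=
  Phi_cyclic (nonself_OU_seq D i).

(** * Reidemeister moves *)

(* Lifts to R of the homeomorphisms of the circle R/Z, of either orientation. *)
Definition circle_homeo (phi : R -> R) : Prop :=
  [/\ continuous phi, injective phi
    & (forall t, phi (t + 1) = phi t + 1) \/ (forall t, phi (t + 1) = phi t - 1)].

(* The same unoriented diagram, up to the parametrization of the components. *)
Definition same_diagram X r (D E : diagram X r) : Prop :=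
  exists phi : 'I_r -> R -> R,
    [/\ forall i, circle_homeo (phi i),
        forall i t, curve E i t = curve D i (phi i t)
      & forall p q, meets (curve E) p q ->
          over E p.1 p.2 = over D p.1 (phi p.1 p.2)].

(* A tangle picture: n arcs in the square, parametrized by [-1, 1]. *)
Definition picture n := 'I_n -> R -> R * R.

(* [D] and [D'] coincide outside a disk, in which they consist of n strands
   forming the pictures [T] and [T'] respectively.  The disk has one
   parametrization for each picture, the two being equal on the boundary, so
   that the interior may be deformed by any homeomorphism fixing the boundary.
   The strand k lies on the component [c k], where it is the arc of parameters
   [a k + l k * s] for [s] in [-1, 1]; a negative [l k] means that the picture
   of the strand is traversed backwards.  The strands are listed from top to
   bottom: if two different ones cross, that of least index is over. *)
Definition replacement X r n (T T' : picture n) (c : 'I_n -> 'I_r)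
    (D D' : diagram X r) : Prop :=
  exists (e e' : R * R -> R * R * R) (a l : 'I_n -> R),
  let strand k s := (c k, a k + l k * s) in
  let in_strands p := exists k s, `|s| <= 1 /\ same_point p (strand k s) in
  [/\ [/\ disk_embedding X e, disk_embedding X e',
          e @` square = e' @` square & {in square_boundary, e =1 e'}],
      (forall k, l k != 0) /\
      (forall k s k' s', `|s| <= 1 -> `|s'| <= 1 ->
         same_point (strand k s) (strand k' s') -> k = k' /\ s = s'),
      forall k s, `|s| <= 1 ->
        curve D (strand k s).1 (strand k s).2 = e (T k s) /\
        curve D' (strand k s).1 (strand k s).2 = e' (T' k s),
      forall p, ~ in_strands p ->
        [/\ ~ (e @` square) (curve D p.1 p.2),
            curve D' p.1 p.2 = curve D p.1 p.2
          & forall q, meets (curve D) p q -> over D' p.1 p.2 = over D p.1 p.2]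
    & forall k s k' s', `|s| <= 1 -> `|s'| <= 1 -> k <> k' ->
        let p := strand k s in let q := strand k' s' in
        (meets (curve D) p q -> over D p.1 p.2 = (k < k')%N) /\
        (meets (curve D') p q -> over D' p.1 p.2 = (k < k')%N)].

Definition RI_before : picture 1 := fun _ s => (s, 0).

(* A curl, with double point (0, 1/4) for s = 1 / sqrt 2 and s = - 1 / sqrt 2. *)
Definition RI_after : picture 1 :=
  fun _ s => (2 * s ^+ 3 - s, (1 - s ^+ 2) / 2).

Definition RII_before : picture 2 :=
  fun k s => if val k == 0%N then (s, 0) else (s, 1 / 2).

(* The two arcs cross twice, at (-1/2, 0) and (1/2, 0). *)
Definition RII_after : picture 2 :=
  fun k s => if val k == 0%N then (s, 0) else (s, `|s| - 1 / 2).

(* The two diagonals of the square, and a third arc from (-1, 0) to (1, 0), on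
   one side (y > 0) or the other (y < 0) of the crossing of the diagonals. *)
Definition RIII_before : picture 3 := fun k s =>
  match val k with
  | 0 => (s, s)
  | 1 => (s, - s)
  | _ => (s, (1 - `|s|) / 2)
  end.

Definition RIII_after : picture 3 := fun k s =>
  match val k with
  | 0 => (s, s)
  | 1 => (s, - s)
  | _ => (s, - (1 - `|s|) / 2)
  end.

(* For an RIII move, the function from 'I_3 gives the components containing the
   upper, middle and lower segments, in this order. *)
Variant move_type (r : nat) := RI | RII | RIII of ('I_3 -> 'I_r).

(* The permutation of the arcs of the picture makes any of them the upper one
   (the middle one, the lower one). *)
Definition elementary_move X r (m : move_type r) (D D' : diagram X r) : Prop :=
  match m with
  | RI => exists c, replacement RI_before RI_after c D D'
  | RII => exists c (pi : 'S_2),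
      replacement (RII_before \o pi) (RII_after \o pi) c D D'
  | RIII c => exists pi : 'S_3,
      replacement (RIII_before \o pi) (RIII_after \o pi) c D D'
  end.

Definition reidemeister_move X r (m : move_type r) (D D' : diagram X r) : Prop :=
  exists E E' : diagram X r,
    [/\ same_diagram D E, same_diagram D' E'
      & elementary_move m E E' \/ elementary_move m E' E].

End Diagrams.

Arguments RI {r}.
Arguments RII {r}.

Definition upper : 'I_3 := inord 0.
Definition middle : 'I_3 := inord 1.
Definition lower : 'I_3 := inord 2.

Definition RIII_alpha r (m : move_type r) : Prop :=
  match m with
  | RIII c => c upper <> c middle /\ c middle <> c lower
  | _ => False
  end.

(* Main.v *)
From mathcomp Require Import all_boot all_order all_algebra all_fingroup.
From mathcomp Require Import finmap.
From mathcomp Require Import all_classical all_reals all_analysis.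
From mathcomp Require Import lra zify ring.
Require Import Defs.
Set Implicit Arguments.
Unset Strict Implicit.
Unset Printing Implicit Defensive.
Import Order.TTheory GRing.Theory Num.Theory.
Import numFieldNormedType.Exports.
Local Open Scope classical_set_scope.
Local Open Scope ring_scope.

(** Let each letter act on the integers by a reflection: [Over] sends v to
    -1 - v and [Under] sends v to 1 - v.  Unfolding the alternating signs in
    the definition of Phi shows that a word S, read as a composite of
    reflections, is the isometry sending v to 2 Phi(S) + (-1)^|S| v.  So Phi and
    the parity of the length depend only on the image of S in the infinite
    dihedral group, where every letter is an involution: a block of equal
    letters may be replaced by any block of the same letter whose length has the
    same parity ([eq_flips_Phi_cyclic], [flips_nseq]).  The dummy value of
    [Phi_cyclic] in odd length depends only on that image as well, so the
    argument is uniform in the parity.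

    The non-self crossings of a component are encoded as a periodic set of
    labelled real parameters, a [marking].  The OU number may be read off from
    any starting point, and after any reparametrization of the circle
    ([Phi_letters_base], [Phi_letters_reparam]); this handles the change
    of parametrization allowed before and after a move.

    A move changes the marking only on the arcs formed by the strands in the
    disk.  These are treated one at a time by [Phi_letters_arcs]: it is enough
    that on each arc all the letters are equal, before and after, and that the
    parity of their number is preserved.  The letters on strand k are equal as
    soon as k does not lie strictly between two strands of other components,
    because a crossing of k with k' is read over exactly when k < k'; only the
    middle segment of an RIII move could violate this, and it does so exactly
    for RIIIalpha.  As for the parity: the non-self crossings of a strand are
    absent in RI; in RII their number goes from zero to zero or two, according to
    whether both strands belong to one component; and RIII rotates the picture by
    a half turn, which reverses the order of the crossings of each strand but
    preserves their number. *)

(** * Words of over/under letters as isometries of the integers *)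

(** The reflection by which a letter acts; prepending a letter to a word changes
    the signs of the positions of all the others, whence the minus sign. *)
Definition flip (x : letter) (v : int) : int :=
  (if x is Over then -1 else 1) - v.

Definition flips (S : seq letter) (v : int) : int := foldr flip v S.

Lemma flipK x : involutive (flip x).
Proof. by move=> v; rewrite /flip opprB addrC subrK. Qed.

Lemma flips_cat S S' v : flips (S ++ S') v = flips S (flips S' v).
Proof. exact: foldr_cat. Qed.

Lemma flips_revK S v : flips (rev S) (flips S v) = v.
Proof.
elim: S v => [//|x S IHS] v.
by rewrite rev_cons -cats1 flips_cat /= flipK IHS.
Qed.

Lemma flips_nseq n x v : flips (nseq n x) v = if odd n then flip x v else v.
Proof. by elim: n => [//|n /= ->]; case: (odd n); rewrite /= ?flipK. Qed.

(** The translation part of the isometry is twice Phi (see [Phi_seq_flips]), and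
    its linear part remembers the parity of the length. *)
Lemma flips_affine S v : flips S v = flips S 0 + (-1) ^+ odd (size S) * v.
Proof.
elim: S => [|x S] /=; first by rewrite add0r mul1r.
move=> ->; rewrite /flip opprD addrA; congr (_ + _).
by case: (odd _); rewrite /= ?expr0 ?expr1 ?mul1r ?mulN1r ?opprK.
Qed.

Lemma Phi_seq_flips S : Phi_seq S = (flips S 0)%:~R / 2.
Proof.
rewrite /Phi_seq; congr (_%:~R / _).
elim: S => [|x S IHS] /=; first by rewrite big_ord0.
rewrite big_ord_recl /= /flip -IHS -sumrN; congr (_ + _).
by apply: eq_bigr => i _; rewrite /bump add1n epsS.
Qed.

(** Both the sum in Phi and the parity test in [Phi_cyclic] are recovered from
    the values of the isometry at 0 and 1. *)
Lemma eq_flips_Phi_cyclic S S' :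
  flips S =1 flips S' -> Phi_cyclic S = Phi_cyclic S'.
Proof.
move=> eqS; have sz : odd (size S) = odd (size S').
  have := eqS 1; rewrite flips_affine (flips_affine S') eqS !mulr1.
  by move/addrI/signr_inj.
by rewrite /Phi_cyclic sz !Phi_seq_flips eqS.
Qed.

(** Reversing a word inverts its isometry, and in even length this is the
    opposite translation. *)
Lemma Phi_cyclic_rev S : Phi_cyclic (rev S) = Phi_cyclic S.
Proof.
rewrite /Phi_cyclic size_rev; case: ifPn => // even_S.
have := flips_revK S 0; rewrite flips_affine size_rev (negbTE even_S) mul1r.
move/eqP; rewrite addr_eq0 !Phi_seq_flips => /eqP ->.
by rewrite mulrNz mulNr normrN.
Qed.

(** * Reading the letters of a finite set of parameters in increasing order *)

Section Letters.
Variable R : realType.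
Implicit Types (A B P : set R) (w : R -> bool).

Definition enumeration A : seq R := sort <=%R (enum_fset (fset_set A)).

Definition letters w A : seq letter :=
  [seq if w t then Over else Under | t <- enumeration A].

Lemma mem_enumeration A t :
  finite_set A -> reflect (A t) (t \in enumeration A).
Proof.
by move=> finA; rewrite mem_sort in_fset_set//; apply: (iffP idP); rewrite inE.
Qed.

Lemma enumeration_sorted A : sorted <%R (enumeration A).
Proof. by rewrite sort_lt_sorted fset_uniq. Qed.

Lemma eq_enumeration A s : finite_set A -> sorted <%R s ->
  (forall t, t \in s <-> A t) -> enumeration A = s.
Proof.
move=> finA s_lt sA; apply: lt_sorted_eq => //.
  exact: enumeration_sorted.
by move=> t; apply/(mem_enumeration t finA)/idP => /sA.
Qed.

Lemma eq_letters w v A : finite_set A ->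
  (forall t, A t -> w t = v t) -> letters w A = letters v A.
Proof.
move=> finA eq_wv; apply/eq_in_map => t /(mem_enumeration t finA) /eq_wv.
by move=> ->.
Qed.

Lemma letters_setU w A B : finite_set A -> finite_set B ->
  (forall a b, A a -> B b -> a < b) ->
  letters w (A `|` B) = letters w A ++ letters w B.
Proof.
move=> finA finB ltAB; rewrite -map_cat; congr map; apply: eq_enumeration.
- by rewrite finite_setU.
- have := enumeration_sorted A; have := enumeration_sorted B.
  rewrite !(sorted_pairwise lt_trans) pairwise_cat => -> ->; rewrite !andbT.
  apply/allrelP => a b /(mem_enumeration a finA) Aa /(mem_enumeration b finB).
  exact: ltAB.
- move=> t; rewrite mem_cat; split.
    by case/orP=> [/(mem_enumeration t finA)|/(mem_enumeration t finB)];
      [left|right].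
  by case=> [/(mem_enumeration t finA)|/(mem_enumeration t finB)] ->;
    rewrite ?orbT.
Qed.

Lemma letters_image w A (f : R -> R) : finite_set A ->
  {in A &, {homo f : s t / s < t}} -> letters w (f @` A) = letters (w \o f) A.
Proof.
move=> finA f_lt; rewrite /letters (@eq_enumeration _ (map f (enumeration A))).
- by rewrite -map_comp.
- exact: finite_image.
- apply: (homo_sorted_in (P := mem A) f_lt _ (enumeration_sorted A)).
  by apply/allP => t /(mem_enumeration t finA) At; rewrite inE.
- move=> t; split=> [/mapP[s /(mem_enumeration s finA) As ->]|].
    by exists s.
  by case=> s As <-; apply/map_f/(mem_enumeration s finA).
Qed.

Lemma letters_image_rev w A (f : R -> R) : finite_set A ->
  {in A &, {homo f : s t /~ s < t}} ->
  letters w (f @` A) = rev (letters (w \o f) A).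
Proof.
move=> finA f_gt.
rewrite /letters (@eq_enumeration _ (rev (map f (enumeration A)))).
- by rewrite map_rev -map_comp.
- exact: finite_image.
- rewrite rev_sorted.
  have f_gt' : {in A &, {homo f : s t / s < t >-> t < s}}.
    by move=> s t As At; apply: f_gt.
  apply: (homo_sorted_in (P := mem A) f_gt' _ (enumeration_sorted A)).
  by apply/allP => t /(mem_enumeration t finA) At; rewrite inE.
- move=> t; rewrite mem_rev.
  split=> [/mapP[s /(mem_enumeration s finA) As ->]|].
    by exists s.
  by case=> s As <-; apply/map_f/(mem_enumeration s finA).
Qed.

Lemma letters_const w A (b : bool) : finite_set A ->
  (forall t, A t -> w t = b) ->
  letters w A = nseq #|` fset_set A| (if b then Over else Under).
Proof.
move=> finA wb; rewrite (eq_letters (v := fun=> b))// /letters.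
rewrite -(size_sort <=%R) -/(enumeration A).
by elim: (enumeration A) => //= _ s ->.
Qed.

(** * Periodic sets of labelled parameters *)

Lemma periodic_translate (T : Type) (f : R -> T) :
  (forall t, f (t + 1) = f t) -> forall (z : int) t, f (t + z%:~R) = f t.
Proof.
move=> f1 z t; have f_nat (n : nat) u : f (u + n%:R) = f u.
  by elim: n => [|n IHn]; rewrite ?addr0// -natr1 addrA f1.
case: (intP z) => [|n|n]; [exact: (f_nat 0%N)|exact: f_nat|].
by rewrite mulrNz -(f_nat n.+1) subrK.
Qed.

(** The crossings met along a closed curve, seen on the universal cover of the
    circle of parameters. *)
Definition marking P w := [/\ forall t, P (t + 1) <-> P t,
  forall t, w (t + 1) = w t & finite_set (P `&` `[0, 1[)].

Section Marking.
Variables (P : set R) (w : R -> bool).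
Hypothesis markP : marking P w.

Lemma marking_translate (z : int) t :
  (P (t + z%:~R) <-> P t) /\ w (t + z%:~R) = w t.
Proof.
have [P1 w1 _] := markP.
have P1' u : P (u + 1) = P u by apply/propext/P1.
by rewrite (periodic_translate P1') (periodic_translate w1).
Qed.

Lemma image_translate (z : int) (I J : set R) :
  (forall t, J (t + z%:~R) <-> I t) ->
  (fun t => t + z%:~R) @` (P `&` I) = P `&` J.
Proof.
move=> IJ; apply/seteqP; split=> [_ [t [Pt It] <-]|t [Pt Jt]].
  by split; [apply/(marking_translate z t).1|apply/IJ].
exists (t - z%:~R); last by rewrite subrK.
by split; [apply/(marking_translate z _).1|apply/IJ]; rewrite subrK.
Qed.

Lemma marking_finite (b c : R) (I : set R) :
  I `<=` `[b, c] -> finite_set (P `&` I).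
Proof.
move=> Ibc; have [_ _ fin01] := markP.
have fin_nat n (b' : R) : finite_set (P `&` `[b', b' + n%:R[).
  elim: n b' => [|n IHn] b'.
    by rewrite addr0 set_itv_ge ?setI0// bnd_simp ltxx.
  have fin1 (z : int) : finite_set (P `&` `[z%:~R, z%:~R + 1[).
    rewrite -(@image_translate z `[0, 1[); first exact: finite_image.
    by move=> t; rewrite /= !in_itv /=; split; lra.
  (* The last unit of length is covered by two consecutive integer intervals. *)
  apply: (@sub_finite_set _ _ ((P `&` `[b', b' + n%:R[)
    `|` ((P `&` `[(Num.floor (b' + n%:R))%:~R, (Num.floor (b' + n%:R))%:~R + 1[)
    `|` (P `&` `[(Num.floor (b' + n%:R) + 1)%:~R,
                 (Num.floor (b' + n%:R) + 1)%:~R + 1[)))).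
    move=> t [Pt] /=; rewrite !in_itv /= -natr1 => /andP[bt tb].
    have := floor_itv (b' + n%:R); rewrite intrD => /andP[lo hi].
    have [t1|t1] := ltP t (b' + n%:R); first by left; split=> //=; rewrite bt.
    have [t2|t2] := ltP t ((Num.floor (b' + n%:R))%:~R + 1); right;
      [left|right].
      by split=> //; lra.
    by split=> //=; rewrite ?in_itv ?intrD /=; lra.
  by rewrite !finite_setU; split; [exact: IHn|split; exact: fin1].
have [n le_n] : exists n, c < b + n%:R.
  exists (Num.truncn (c - b)).+1.
  by rewrite -ltrBlDl; exact: truncnS_gt.
apply: sub_finite_set (fin_nat n b) => t [Pt /Ibc It]; split=> //.
by move: It; rewrite /= !in_itv /=; lra.
Qed.

(** Moving an initial part I of a fundamental domain to its end, by one period,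
    rotates the word that is read. *)
Lemma Phi_letters_rot (I J : set R) (b : R) :
  I `<=` `[b, b + 1] -> J `<=` `[b, b + 1] ->
  (forall s t, I s -> J t -> s < t < s + 1) ->
  Phi_cyclic (letters w (P `&` (I `|` J))) =
  Phi_cyclic (letters w (P `&` (J `|` [set t | I (t - 1)]))).
Proof.
move=> Ib Jb IJ; rewrite !setIUr.
have finI := marking_finite Ib; have finJ := marking_finite Jb.
have shiftI : (fun t => t + 1%:~R) @` (P `&` I) = P `&` [set t | I (t - 1)].
  by apply: image_translate => t /=; rewrite addrK.
rewrite letters_setU//; last first.
  by move=> s t [_ Is] [_ Jt]; case/andP: (IJ _ _ Is Jt).
rewrite letters_setU//; last 2 first.
- by rewrite -shiftI; exact: finite_image.
- by move=> t s [_ Jt] [_ /= /IJ/(_ Jt)]; lra.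
rewrite -shiftI letters_image//; last by move=> s t _ _; rewrite ltrD2r.
rewrite (@eq_letters _ w)//; last first.
  by move=> t _; exact: (marking_translate 1 t).2.
by rewrite -(Phi_cyclic_rot (size (letters w (P `&` I)))) rot_size_cat.
Qed.

(** Within one period, moving the starting point rotates the word; integer
    translations do not change it at all. *)
Lemma Phi_letters_base (b : R) :
  Phi_cyclic (letters w (P `&` `[b, b + 1[)) =
  Phi_cyclic (letters w (P `&` `[0, 1[)).
Proof.
have near_base b' c : b' <= c <= b' + 1 ->
    Phi_cyclic (letters w (P `&` `[b', b' + 1[)) =
    Phi_cyclic (letters w (P `&` `[c, c + 1[)).
  move=> b'c.
  have -> : `[b', b' + 1[%classic = `[b', c[%classic `|` `[c, b' + 1[%classic.
    apply/seteqP; split=> t /=; rewrite !in_itv /=.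
      by move=> bt; have [tc|tc] := ltP t c; [left|right]; lra.
    by case; lra.
  rewrite (@Phi_letters_rot _ _ b').
  - congr (Phi_cyclic (letters w (P `&` _))).
    apply/seteqP; split=> t /=; rewrite !in_itv /=; first by case; lra.
    by move=> ct; have [tb|tb] := ltP t (b' + 1); [left|right]; lra.
  - by move=> t /=; rewrite !in_itv /=; lra.
  - by move=> t /=; rewrite !in_itv /=; lra.
  - by move=> s t /=; rewrite !in_itv /=; lra.
have [lo hi] : (Num.floor b)%:~R <= b /\ b < (Num.floor b)%:~R + 1.
  by have /andP[] := floor_itv b; rewrite intrD.
rewrite -(near_base (Num.floor b)%:~R); last by lra.
rewrite -(@image_translate (Num.floor b) `[0, 1[); last first.
  by move=> t /=; rewrite !in_itv /=; split; lra.
rewrite letters_image//; last 2 first.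
- by case: markP.
- by move=> s t _ _; rewrite ltrD2r.
rewrite (@eq_letters _ w)//; first by case: markP.
by move=> t _; exact: (marking_translate _ t).2.
Qed.

(** The fundamental domain open on the left is the one that arises when the
    orientation is reversed. *)
Lemma Phi_letters_base_right (b : R) :
  Phi_cyclic (letters w (P `&` `]b, b + 1])) =
  Phi_cyclic (letters w (P `&` `[0, 1[)).
Proof.
rewrite -(Phi_letters_base b).
have -> : `[b, b + 1[%classic = [set b] `|` `]b, b + 1[%classic.
  apply/seteqP; split=> t /=; rewrite !in_itv /=; last by case=> [->|]; lra.
  by have [->|bt] := eqVneq t b; [left|right; move: bt; lra].
rewrite (@Phi_letters_rot _ _ b).
- congr (Phi_cyclic (letters w (P `&` _))).
  apply/seteqP; split=> t /=; rewrite !in_itv /=; last first.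
    by case=> [|tb]; lra.
  by have [tb|tb] := ltP t (b + 1); [left|right]; lra.
- by move=> t /= ->; rewrite in_itv /=; lra.
- by move=> t /=; rewrite !in_itv /=; lra.
- by move=> s t /= ->; rewrite in_itv /=; lra.
Qed.

End Marking.

(** The lift of a map of degree 1 or -1 is unbounded in both directions, so the
    intermediate value theorem applies. *)
Lemma circle_homeo_surj (phi : R -> R) :
  circle_homeo phi -> forall u, exists t, phi t = u.
Proof.
case=> phi_cont _ phi_deg u; pose N : R := (Num.truncn `|u - phi 0|).+1%:R.
have uN : `|u - phi 0| < N by exact: truncnS_gt.
have phiN : phi N = phi 0 + N /\ phi (- N) = phi 0 - N \/
            phi N = phi 0 - N /\ phi (- N) = phi 0 + N.
  case: phi_deg => deg; [left|right].
    have per t : phi (t + 1) - (t + 1) = phi t - t by rewrite deg; lra.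
    have := periodic_translate per (Num.truncn `|u - phi 0|).+1 0.
    have := periodic_translate per (- (Num.truncn `|u - phi 0|).+1%:Z) 0.
    by rewrite !add0r mulrNz -/N; lra.
  have per t : phi (t + 1) + (t + 1) = phi t + t by rewrite deg; lra.
  have := periodic_translate per (Num.truncn `|u - phi 0|).+1 0.
  have := periodic_translate per (- (Num.truncn `|u - phi 0|).+1%:Z) 0.
  by rewrite !add0r mulrNz -/N; lra.
have [|||t _ tu] := @IVT R phi (- N) N u; last by exists t.
- by have := normr_ge0 (u - phi 0); lra.
- exact: continuous_subspaceT.
- move: uN; rewrite ltr_norml ge_min le_max => /andP[].
  by case: phiN => -[-> ->] lo hi; apply/andP; split; apply/orP;
    by [left; lra|right; lra].
Qed.

(** The lift of a circle homeomorphism is strictly monotonic: it maps one period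
    onto one period, and it preserves or reverses the order of the letters. *)
Lemma Phi_letters_reparam P Q w v (phi : R -> R) :
  marking P w -> marking Q v -> circle_homeo phi ->
  (forall t, Q t <-> P (phi t)) -> (forall t, Q t -> v t = w (phi t)) ->
  Phi_cyclic (letters v (Q `&` `[0, 1[)) =
  Phi_cyclic (letters w (P `&` `[0, 1[)).
Proof.
move=> mP mQ phi_homeo QP vw.
have [phi_cont phi_inj phi_deg] := phi_homeo.
have finQ : finite_set (Q `&` `[0, 1[) by case: mQ.
have -> : letters v (Q `&` `[0, 1[) = letters (w \o phi) (Q `&` `[0, 1[).
  by apply: eq_letters => // t [/vw].
have phi_onto := circle_homeo_surj phi_homeo.
have phi1 : phi 1 = phi 0 + 1 \/ phi 1 = phi 0 - 1.
  by case: phi_deg => /(_ 0); rewrite add0r; [left|right].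
have [phi_lt|phi_gt] : {homo phi : s t / s < t} \/ {homo phi : s t /~ s < t}.
  have [] := @itv_continuous_inj_mono R phi `]-oo, +oo[.
  - exact: continuous_subspaceT.
  - by move=> s t _ _; exact: phi_inj.
  - by move=> lt; left=> s t; apply: lt; rewrite in_itv.
  - by move=> lt; right=> s t; apply: lt; rewrite in_itv.
- have {}phi1 : phi 1 = phi 0 + 1 by have := phi_lt _ _ (@ltr01 R); lra.
  rewrite -letters_image//; last by move=> s t _ _; exact: phi_lt.
  rewrite -(Phi_letters_base mP (phi 0)).
  congr (Phi_cyclic (letters w _)); apply/seteqP; split=> [_ [t [Qt t01] <-]|u].
    split; first exact/QP.
    move: t01; rewrite /= !in_itv /= -phi1 => /andP[t0 t1].
    by rewrite (ltW_homo phi_lt)// phi_lt.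
  case=> Pu; rewrite /= in_itv /= => u01.
  have [t tu] := phi_onto u.
  exists t => //; split; first by apply/QP; rewrite tu.
  move: u01; rewrite -tu -phi1 => /andP[t0 t1]; rewrite /= in_itv /=.
  by rewrite -(le_mono phi_lt) t0 -(leW_mono (le_mono phi_lt)).
- have {}phi1 : phi 1 = phi 0 - 1 by have := phi_gt _ _ (@ltr01 R); lra.
  rewrite -Phi_cyclic_rev -letters_image_rev//; last first.
    by move=> s t _ _; exact: phi_gt.
  rewrite -(Phi_letters_base_right mP (phi 1)).
  congr (Phi_cyclic (letters w _)); apply/seteqP; split=> [_ [t [Qt t01] <-]|u].
    split; first exact/QP.
    move: t01; rewrite /= !in_itv /= => /andP[t0 t1].
    by rewrite phi_gt//= phi1 subrK (ltW_nhomo phi_gt).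
  case=> Pu; rewrite /= in_itv /= => u01.
  have [t tu] := phi_onto u.
  exists t => //; split; first by apply/QP; rewrite tu.
  move: u01; rewrite -tu phi1 subrK -phi1 => /andP[t1 t0]; rewrite /= in_itv /=.
  by rewrite -(le_nmono phi_gt) t0 -(leW_nmono (le_nmono phi_gt)).
Qed.

(** Read from x, both words are a block of equal letters followed by the same
    word, and in the dihedral group only the parity of the block matters. *)
Lemma Phi_letters_arc P P' w w' (x y : R) (b : bool) :
  marking P w -> marking P' w' -> x <= y < x + 1 ->
  (forall t, y < t < x + 1 -> (P t <-> P' t) /\ (P t -> w t = w' t)) ->
  (forall t, x <= t <= y -> (P t -> w t = b) /\ (P' t -> w' t = b)) ->
  odd #|` fset_set (P `&` `[x, y])| = odd #|` fset_set (P' `&` `[x, y])| ->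
  Phi_cyclic (letters w (P `&` `[0, 1[)) =
  Phi_cyclic (letters w' (P' `&` `[0, 1[)).
Proof.
move=> mP mP' xy off on par.
rewrite -(Phi_letters_base mP x) -(Phi_letters_base mP' x).
have -> : `[x, x + 1[%classic = `[x, y]%classic `|` `]y, x + 1[%classic.
  apply/seteqP; split=> t /=; rewrite !in_itv /=; last by case; lra.
  by move=> xt; have [ty|ty] := leP t y; [left|right]; lra.
have arcE Q v : marking Q v -> (forall t, x <= t <= y -> Q t -> v t = b) ->
    letters v (Q `&` (`[x, y] `|` `]y, x + 1[)) =
    nseq #|` fset_set (Q `&` `[x, y])| (if b then Over else Under)
    ++ letters v (Q `&` `]y, x + 1[).
  move=> mQ Qb; have fin := @marking_finite _ _ mQ x (x + 1).
  have finxy : finite_set (Q `&` `[x, y]).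
    by apply: fin => t /=; rewrite !in_itv /=; lra.
  rewrite setIUr letters_setU//.
  - congr (_ ++ _); apply: letters_const => // t [Qt].
    by rewrite /= in_itv /= => xty; exact: Qb.
  - by apply: fin => t /=; rewrite !in_itv /=; lra.
  - by move=> s t [_ /=] + [_ /=]; rewrite !in_itv /=; lra.
rewrite !arcE//; try by move=> t /on[].
have -> : P' `&` `]y, x + 1[ = P `&` `]y, x + 1[.
  by apply/seteqP; split=> t [Pt ty]; split=> //; move: (ty);
    rewrite /= in_itv /= => /off[PP' _]; apply/PP'.
rewrite -(@eq_letters w w').
- by apply: eq_flips_Phi_cyclic => v; rewrite !flips_cat !flips_nseq par.
- by apply: (@marking_finite _ _ mP x (x + 1)) => t /=; rewrite !in_itv /=; lra.
- by move=> t [Pt]; rewrite /= in_itv /= => /off[_]; exact.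
Qed.

(** The preimage in R of the arc of R/Z onto which the interval from x to y
    projects. *)
Definition on_arc (x y t : R) := exists z : int, x <= t + z%:~R <= y.

(** Two markings may be exchanged on an arc, by [Phi_letters_arc]. *)
Definition exchangeable P w P' w' (x y : R) :=
  [/\ x <= y < x + 1,
      exists b : bool, forall t, x <= t <= y ->
        (P t -> w t = b) /\ (P' t -> w' t = b)
    & odd #|` fset_set (P `&` `[x, y])| = odd #|` fset_set (P' `&` `[x, y])|].

(** By induction on the arcs: the markings that carry the new crossings on some
    of the arcs and the old ones elsewhere interpolate between both markings.
    They are not markings of diagrams in general, which is why this is stated
    for abstract markings. *)
Lemma Phi_letters_arcs (I : eqType) (ks : seq I) (x y : I -> R) P w P' w' :
  marking P w -> marking P' w' -> uniq ks ->
  {in ks &, forall k k' t,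
    on_arc (x k) (y k) t -> on_arc (x k') (y k') t -> k = k'} ->
  (forall k, k \in ks -> exchangeable P w P' w' (x k) (y k)) ->
  (forall t, (forall k, k \in ks -> ~ on_arc (x k) (y k) t) ->
    (P t <-> P' t) /\ (P t -> w t = w' t)) ->
  Phi_cyclic (letters w (P `&` `[0, 1[)) =
  Phi_cyclic (letters w' (P' `&` `[0, 1[)).
Proof.
move=> + mP'; elim: ks P w => [|k ks IHks] P w mP /=.
  move=> _ _ _ off.
  have {}off t : (P t <-> P' t) /\ (P t -> w t = w' t) by exact: off.
  have -> : P' = P by apply/seteqP; split=> t; apply (off t).1.
  congr Phi_cyclic; apply: eq_letters; first by case: mP.
  by move=> t [/(off t).2].
case/andP=> k_ks uniq_ks disj arcs off.
pose on_k t := `[< on_arc (x k) (y k) t >].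
have on_k1 t : on_k (t + 1) = on_k t.
  apply/asboolP/asboolP => -[z tz]; [exists (z + 1)|exists (z - 1)].
    by rewrite intrD; lra.
  by rewrite intrB; lra.
(* The marking in which only the first arc has been changed. *)
pose P1 := [set t | if on_k t then P' t else P t].
pose w1 t := if on_k t then w' t else w t.
have mP1 : marking P1 w1.
  split=> [t|t|].
  - by rewrite /P1 /= on_k1; case: mP mP' => P_1 _ _ [P'_1 _ _]; case: ifP.
  - by rewrite /w1 on_k1; case: mP mP' => _ -> _ [_ -> _].
  - apply: (@sub_finite_set _ _ (P `&` `[0, 1[ `|` P' `&` `[0, 1[)).
      by move=> t [+ t01]; rewrite /P1 /=; case: ifP => _ Pt; [right|left].
    by rewrite finite_setU; case: mP mP' => _ _ + [].
have [xy [b on_b] par] := arcs k (mem_head _ _).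
have in_k t : x k <= t <= y k -> on_k t.
  by move=> xty; apply/asboolP; exists 0; rewrite addr0.
have out_k t : y k < t < x k + 1 -> ~~ on_k t.
  move=> yt; apply/asboolP => -[z tz].
  have : (-1 : int)%:~R < z%:~R :> R by rewrite mulrNz; lra.
  have : z%:~R < (0 : int)%:~R :> R by lra.
  by rewrite !ltr_int; lia.
have -> : Phi_cyclic (letters w (P `&` `[0, 1[)) =
          Phi_cyclic (letters w1 (P1 `&` `[0, 1[)).
  apply: (Phi_letters_arc (b := b) mP mP1 xy).
  - by move=> t /out_k/negbTE t_out; rewrite /P1 /w1 /= t_out.
  - by move=> t xty; rewrite /P1 /w1 /= in_k//; exact: on_b.
  - rewrite par; congr (odd #|` fset_set _|); apply/seteqP.
    by split=> t [Pt xty]; split=> //; move: Pt; rewrite /P1 /= in_k//;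
      move: xty; rewrite /= in_itv.
apply: (IHks P1 w1 mP1 uniq_ks).
- by move=> k1 k2 ks1 ks2; apply: disj; rewrite inE ?ks1 ?ks2 orbT.
- move=> k' k'_ks; have k'k : k' != k by apply: contraNneq k_ks => <-.
  have k'_kks : k' \in k :: ks by rewrite inE k'_ks orbT.
  have off_k t : x k' <= t <= y k' -> on_k t = false.
    move=> xty; apply/asboolP => t_k; move/eqP: k'k; apply.
    apply: (disj k' k k'_kks (mem_head _ _) t _ t_k).
    by exists 0; rewrite addr0.
  have [xy' [b' on_b'] par'] := arcs k' k'_kks.
  split=> //.
    by exists b' => t xty; rewrite /P1 /w1 /= off_k//; exact: on_b'.
  rewrite -par'; congr (odd #|` fset_set _|); apply/seteqP.
  by split=> t [Pt xty]; split=> //; move: Pt; rewrite /P1 /= off_k//;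
    move: xty; rewrite /= in_itv.
- move=> t off_ks; rewrite /P1 /w1 /=; case: ifPn => // /asboolPn t_off.
  by apply: off => k'; rewrite inE => /predU1P[->|/off_ks].
Qed.

End Letters.

(** * The OU number of a diagram *)

Section OUNumber.
Variables (R : realType) (X : surface) (r : nat).
Implicit Types (D E : diagram R X r) (i : 'I_r).

(** The set [nonself_params] without the restriction to one period. *)
Definition nonself D i : set R :=
  [set t | exists j s, j <> i /\ curve D i t = curve D j s].

Lemma curve_translate D i (z : int) t : curve D i (t + z%:~R) = curve D i t.
Proof. exact: (periodic_translate (@curve_periodic _ _ _ D i)). Qed.

Lemma nonself_paramsE D i : nonself_params D i = nonself D i `&` `[0, 1[.
Proof.
by apply/seteqP; split=> t; rewrite /= in_itv /= => -[? ?]; split.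
Qed.

Lemma meets_nonself D i j s t :
  j <> i -> curve D i t = curve D j s -> meets (curve D) (i, t) (j, s).
Proof. by move=> ji eq_c; split=> // -[/esym]. Qed.

Lemma nonself_marking D i : marking (nonself D i) (over D i).
Proof.
split=> [t|t|]; first by rewrite /nonself /= curve_periodic.
  exact: over_periodic.
apply: sub_finite_set (finite_crossings D i) => t [[j [s [ji eq_c]]]].
rewrite /= in_itv /= => t01; split=> //; exists (j, s); exact: meets_nonself.
Qed.

Lemma OU_number_letters D i : OU_number D i =
  Phi_cyclic (letters (over D i) (nonself D i `&` `[0, 1[)).
Proof. by rewrite /OU_number /nonself_OU_seq nonself_paramsE. Qed.

Lemma OU_number_same_diagram D E i :
  same_diagram D E -> OU_number E i = OU_number D i.
Proof.
case=> phi [phi_homeo curveE overE]; rewrite !OU_number_letters.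
apply: (Phi_letters_reparam (nonself_marking D i) (nonself_marking E i)
  (phi_homeo i)).
- move=> t; split=> -[j [s [ji eq_c]]]; exists j.
    by exists (phi j s); split=> //; rewrite -!curveE.
  have [s' s's] := circle_homeo_surj (phi_homeo j) s.
  by exists s'; split=> //; rewrite !curveE s's.
- move=> t [j [s [ji eq_c]]]; apply: (overE (i, t) (j, s)).
  exact: meets_nonself.
Qed.

End OUNumber.

(** * Replacing a picture inside a disk *)

Section Replacement.
Variables (R : realType) (X : surface) (r n : nat).
Variables (c : 'I_n -> 'I_r) (a l : 'I_n -> R).
Hypothesis l_neq0 : forall k, l k != 0.
Hypothesis strand_inj : forall k s k' s', `|s| <= 1 -> `|s'| <= 1 ->
  same_point (c k, a k + l k * s) (c k', a k' + l k' * s') -> k = k' /\ s = s'.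

(** The parameters of the non-self crossings of strand k, computed in the
    picture T; they do not depend on the diagram. *)
Definition foreign_crossings (T : picture R n) (k : 'I_n) : set R :=
  [set s | `|s| <= 1 /\ exists k' s',
    [/\ `|s'| <= 1, c k' <> c k & T k s = T k' s']].

Definition on_strands (p : 'I_r * R) : Prop :=
  exists k s, `|s| <= 1 /\ same_point p (c k, a k + l k * s).

Lemma strand_rangeP k t : reflect (exists2 s, `|s| <= 1 & a k + l k * s = t)
  (a k - `|l k| <= t <= a k + `|l k|).
Proof.
have l0 : 0 < `|l k| by rewrite normr_gt0.
apply: (iffP idP) => [t_in|[s s1 <-]].
  exists ((t - a k) / l k); last by rewrite mulrC divfK// addrC subrK.
  by rewrite normrM normfV ler_pdivrMr// mul1r ler_norml; lra.
have : `|l k * s| <= `|l k| by rewrite normrM ler_piMr.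
by rewrite ler_norml; lra.
Qed.

(** Otherwise two distinct points of the strand would be one period apart. *)
Lemma strand_short k : a k - `|l k| <= a k + `|l k| < a k - `|l k| + 1.
Proof.
have l0 : 0 < `|l k| by rewrite normr_gt0.
suff: `|l k| < 1 / 2 by lra.
rewrite ltNge; apply/negP => l_ge.
have s1 : `|(2 * l k)^-1| <= 1.
  by rewrite normfV invf_le1 normrM ?normr_nat; lra.
have s1' : `|- (2 * l k)^-1| <= 1 by rewrite normrN.
have [|_ /eqP] := strand_inj (k := k) (k' := k) s1' s1.
  split=> //; exists 1 => /=; rewrite invfM; have := l_neq0 k => lk.
  by field.
rewrite eq_sym -addr_eq0 -mulr2n mulrn_eq0 /= invr_eq0 mulf_eq0 pnatr_eq0.
by rewrite (negbTE (l_neq0 k)).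
Qed.

(** The data of [replacement] that concern one of the two diagrams only. *)
Section OneSide.
Variables (T : picture R n) (e : R * R -> R * R * R) (D : diagram R X r).
Hypothesis e_disk : disk_embedding X e.
Hypothesis T_square : forall k s, `|s| <= 1 -> square (T k s).
Hypothesis strandE :
  forall k s, `|s| <= 1 -> curve D (c k) (a k + l k * s) = e (T k s).
Hypothesis off_disk :
  forall p, ~ on_strands p -> ~ (e @` @square R) (curve D p.1 p.2).
Hypothesis over_strands :
  forall k s k' s', `|s| <= 1 -> `|s'| <= 1 -> k <> k' ->
  meets (curve D) (c k, a k + l k * s) (c k', a k' + l k' * s') ->
  over D (c k) (a k + l k * s) = (k < k')%N.

(** What meets a strand is inside the disk, hence belongs to a strand, and the
    crossing is visible in the picture because e is injective. *)
Lemma nonself_strand k s : `|s| <= 1 ->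
  nonself D (c k) (a k + l k * s) -> exists k' s',
    [/\ `|s'| <= 1, c k' <> c k, T k s = T k' s'
      & over D (c k) (a k + l k * s) = (k < k')%N].
Proof.
move=> s1 [j [t [jk]]]; rewrite strandE// => eq_c.
have [k' [s' [s'1 [/= jk' [z /= tz]]]]] : on_strands (j, t).
  apply: contrapT => /off_disk; apply; exists (T k s) => //; exact: T_square.
have eqT : T k s = T k' s'.
  have [_ e_inj _] := e_disk; apply: e_inj; rewrite ?inE; try exact: T_square.
  by rewrite eq_c -strandE// tz -jk' curve_translate.
subst j; exists k', s'; split=> //; apply: (over_strands s1 s'1).
  by move=> kk'; apply: jk; rewrite kk'.
by apply: meets_nonself => //; rewrite !strandE// eqT.
Qed.

Lemma foreign_crossings_nonself k s : `|s| <= 1 ->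
  foreign_crossings T k s <-> nonself D (c k) (a k + l k * s).
Proof.
move=> s1; split=> [[_ [k' [s' [s'1 kk' eqT]]]]|].
  by exists (c k'), (a k' + l k' * s'); rewrite !strandE// eqT.
move/(nonself_strand s1) => [k' [s' [s'1 kk' eqT _]]].
by split=> //; exists k', s'.
Qed.

Lemma nonself_on_strand k :
  nonself D (c k) `&` `[a k - `|l k|, a k + `|l k|] =
  (fun s => a k + l k * s) @` foreign_crossings T k.
Proof.
apply/seteqP; split=> [t [ns_t]|_ [s Ts <-]].
  rewrite /= in_itv /= => /strand_rangeP[s s1 ts].
  by exists s => //; apply/foreign_crossings_nonself => //; rewrite ts.
have s1 : `|s| <= 1 by case: Ts.
split; first exact/foreign_crossings_nonself.
by rewrite /= in_itv /=; apply/strand_rangeP; exists s.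
Qed.

Lemma card_nonself_on_strand k : finite_set (foreign_crossings T k) /\
  #|` fset_set (nonself D (c k) `&` `[a k - `|l k|, a k + `|l k|])| =
  #|` fset_set (foreign_crossings T k)|.
Proof.
have finT : finite_set (foreign_crossings T k).
  have -> : foreign_crossings T k = (fun t => (t - a k) / l k) @`
      (nonself D (c k) `&` `[a k - `|l k|, a k + `|l k|]).
    rewrite nonself_on_strand image_comp -[LHS]image_id.
    by apply: eq_imagel => s _ /=; rewrite addrC addKr mulrC mulKf.
  apply: finite_image; apply: (marking_finite (nonself_marking D (c k))).
  exact: subset_refl.
split=> //; rewrite nonself_on_strand fset_set_image// card_imfset//.
by move=> s s' /addrI/mulfI-> //.
Qed.

End OneSide.
End Replacement.

(** A crossing of strand k with strand k' is read over exactly when k < k', so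
    if k is not strictly between two strands of other components, then its non-self
    crossings are all over or all under. *)
Lemma OU_number_replacement (R : realType) (X : surface) (r n : nat)
    (T T' : picture R n) (c : 'I_n -> 'I_r) (D D' : diagram R X r) i :
  (forall k s, `|s| <= 1 -> square (T k s)) ->
  (forall k s, `|s| <= 1 -> square (T' k s)) ->
  (forall k, finite_set (foreign_crossings c T k) ->
    odd #|` fset_set (foreign_crossings c T k)| =
    odd #|` fset_set (foreign_crossings c T' k)|) ->
  (forall k1 k k2 : 'I_n, (k1 < k < k2)%N -> c k1 = c k \/ c k = c k2) ->
  replacement T T' c D D' -> OU_number D' i = OU_number D i.
Proof.
move=> T_sq T'_sq par not_between.
case=> e [e' [a [l [[e_disk e'_disk eq_disk _] [l_neq0 inj]
  strandsE off overE]]]].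
have strandE k s : `|s| <= 1 -> curve D (c k) (a k + l k * s) = e (T k s).
  by case/(strandsE k).
have strandE' k s : `|s| <= 1 -> curve D' (c k) (a k + l k * s) = e' (T' k s).
  by case/(strandsE k).
have off_disk p : ~ on_strands c a l p -> ~ (e @` @square R) (curve D p.1 p.2).
  by case/off.
have off_disk' p :
    ~ on_strands c a l p -> ~ (e' @` @square R) (curve D' p.1 p.2).
  by move=> /off[+ -> _]; rewrite eq_disk.
have on_disk p : on_strands c a l p ->
    (e @` @square R) (curve D p.1 p.2) /\ (e @` @square R) (curve D' p.1 p.2).
  case: p => _ t [k [s [s1 [/= -> [z tz]]]]].
  rewrite -(curve_translate D _ z) -(curve_translate D' _ z) -tz.
  rewrite strandE// strandE'//.
  split; first by exists (T k s) => //; exact: T_sq.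
  suff: (e' @` @square R) (e' (T' k s)) by rewrite -eq_disk.
  by exists (T' k s) => //; exact: T'_sq.
have over_strands k s k' s' : `|s| <= 1 -> `|s'| <= 1 -> k <> k' ->
    meets (curve D) (c k, a k + l k * s) (c k', a k' + l k' * s') ->
    over D (c k) (a k + l k * s) = (k < k')%N.
  by move=> s1 s'1 kk'; have [+ _] := overE k s k' s' s1 s'1 kk'.
have over_strands' k s k' s' : `|s| <= 1 -> `|s'| <= 1 -> k <> k' ->
    meets (curve D') (c k, a k + l k * s) (c k', a k' + l k' * s') ->
    over D' (c k) (a k + l k * s) = (k < k')%N.
  by move=> s1 s'1 kk'; have [_ +] := overE k s k' s' s1 s'1 kk'.
(* The common value of [over] at all the non-self crossings of strand k. *)
pose over_others (k : 'I_n) := [exists k' : 'I_n, (k < k')%N && (c k' != c k)].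
have over_othersE (k k' : 'I_n) : c k' <> c k -> (k < k')%N = over_others k.
  move=> ckk'; apply/idP/existsP => [kk'|[k2 /andP[kk2 ck2]]].
    by exists k'; rewrite kk'; apply/eqP.
  have [//|k'k] := ltnP k k'; have {}k'k : (k' < k)%N.
    by rewrite ltn_neqAle k'k andbT; apply: contra_notN ckk' => /eqP/val_inj->.
  have [|//|/esym/eqP] := not_between k' k k2; first by rewrite k'k.
  by rewrite (negbTE ck2).
rewrite !OU_number_letters; apply/esym.
apply: (@Phi_letters_arcs R _ (enum [pred k | c k == i])
  (fun k => a k - `|l k|) (fun k => a k + `|l k|)).
- exact: nonself_marking.
- exact: nonself_marking.
- exact: enum_uniq.
- move=> k k'; rewrite !mem_enum !inE => /eqP ck /eqP ck' t.
  case=> z /(strand_rangeP a l_neq0)[s s1 sz].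
  case=> z' /(strand_rangeP a l_neq0)[s' s'1 s'z'].
  have [|->//] := inj k s k' s' s1 s'1.
  split=> /=; first by rewrite ck ck'.
  by exists (z' - z); rewrite sz s'z' intrB; lra.
- move=> k; rewrite mem_enum inE => /eqP <-.
  split; first exact: strand_short l_neq0 inj k.
    exists (over_others k) => t /(strand_rangeP a l_neq0)[s s1 <-]; split.
      by case/(nonself_strand e_disk T_sq strandE off_disk over_strands s1)
        => k' [s' [_ kk' _ ->]]; exact: over_othersE.
    by case/(nonself_strand e'_disk T'_sq strandE' off_disk' over_strands' s1)
      => k' [s' [_ kk' _ ->]]; exact: over_othersE.
  have [finT ->] := card_nonself_on_strand l_neq0 e_disk T_sq
    strandE off_disk over_strands k.
  have [_ ->] := card_nonself_on_strand l_neq0 e'_disk T'_sq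
    strandE' off_disk' over_strands' k.
  exact: par.
- move=> t off_arcs.
  have off_t : ~ on_strands c a l (i, t).
    case=> k [s [s1 [/= ik [z tz]]]]; apply: (off_arcs k).
      by rewrite mem_enum inE ik.
    by exists z; apply/(strand_rangeP a l_neq0); exists s.
  have [not_e eq_c eq_over] := off _ off_t.
  have off_partner j s :
      curve D i t = curve D j s \/ curve D' i t = curve D' j s ->
      curve D' j s = curve D j s.
    (* The partner of a point outside the disk is outside the strands too. *)
    move=> eq_j; suff j_off : ~ on_strands c a l (j, s).
      by have [] := off _ j_off.
    move=> /on_disk[js js']; apply: not_e => /=.
    by case: eq_j => [->//|eq_j]; rewrite -eq_c /= eq_j.
  split.
    have eq_ct : curve D' i t = curve D i t := eq_c.
    split=> -[j [s [ji eq_j]]]; exists j, s; split=> //.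
      by rewrite eq_ct (off_partner j s (or_introl eq_j)).
    by rewrite -eq_ct -(off_partner j s (or_intror eq_j)).
  case=> j [s [ji eq_j]]; symmetry; apply: (eq_over (j, s)).
  exact: meets_nonself.
Qed.

(** * The three moves *)

Section Moves.
Variable R : realType.

Lemma perm2_vals (pi : 'S_2) (k k' : 'I_2) : k' <> k ->
  val (pi k) = 0%N /\ val (pi k') = 1%N \/
  val (pi k) = 1%N /\ val (pi k') = 0%N.
Proof.
move/eqP; rewrite -(inj_eq (@perm_inj _ pi)).
case: (pi k) (pi k') => [[|[|//]] ?] [[|[|//]] ?]; by [left|right|].
Qed.

Lemma RI_before_square k s : `|s| <= 1 -> square (RI_before (R := R) k s).
Proof. by move=> s1; split; rewrite /= ?normr0. Qed.

Lemma RI_after_square k s : `|s| <= 1 -> square (RI_after (R := R) k s).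
Proof.
move=> s1; have s2 : 0 <= s ^+ 2 <= 1.
  by rewrite sqr_ge0 -real_normK ?num_real// expr_le1.
split; rewrite /=; last by rewrite ler_norml; lra.
have -> : 2 * s ^+ 3 - s = s * (2 * s ^+ 2 - 1) by ring.
by rewrite normrM mulr_ile1// ler_norml; lra.
Qed.

Lemma RII_before_square k s : `|s| <= 1 -> square (RII_before (R := R) k s).
Proof.
move=> s1; rewrite /RII_before; case: ifP => _; split; rewrite /= ?normr0//.
by rewrite ger0_norm; lra.
Qed.

Lemma RII_after_square k s : `|s| <= 1 -> square (RII_after (R := R) k s).
Proof.
move=> s1; rewrite /RII_after; have := normr_ge0 s.
by case: ifP => _ s0; split; rewrite /= ?normr0// ler_norml; lra.
Qed.

Lemma RIII_before_square k s : `|s| <= 1 -> square (RIII_before (R := R) k s).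
Proof.
move=> s1; rewrite /RIII_before; have := normr_ge0 s.
by case: (val k) => [|[|_]] s0; split; rewrite /= ?normrN// ler_norml; lra.
Qed.

(** The two pictures of RIII differ by a half turn, which reverses each strand:
    this is what exchanges the two crossings on every strand. *)
Lemma RIII_afterE k s :
  RIII_after (R := R) k s = - RIII_before k (- s).
Proof.
by rewrite /RIII_after /RIII_before normrN; case: (val k) => [|[|_]];
  congr pair; rewrite /= ?opprK// mulNr.
Qed.

Lemma RIII_after_square k s : `|s| <= 1 -> square (RIII_after (R := R) k s).
Proof.
move=> s1; rewrite RIII_afterE /square /= !normrN.
by apply: RIII_before_square; rewrite normrN.
Qed.

Lemma RII_before_foreign r (c : 'I_2 -> 'I_r) (pi : 'S_2) k :
  foreign_crossings c (RII_before (R := R) \o pi) k = set0.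
Proof.
apply/seteqP; split=> // s [_ [k' [s' [_ ckk']]]].
have /(perm2_vals pi) : k' <> k by move=> kk'; rewrite kk' in ckk'.
by rewrite /= /RII_before /=; case=> -[-> ->] /= [_]; lra.
Qed.

Lemma RII_after_foreign r (c : 'I_2 -> 'I_r) (pi : 'S_2) k k' : c k' <> c k ->
  foreign_crossings c (RII_after (R := R) \o pi) k = [set 1 / 2; - (1 / 2)].
Proof.
move=> ckk'; have half1 : `|1 / 2 : R| = 1 / 2 by rewrite ger0_norm; lra.
have kk' : k' <> k by move=> kk'; rewrite kk' in ckk'.
apply/seteqP; split=> s.
  case=> _ [k2 [s' [_ ck2]]].
  have /(perm2_vals pi) : k2 <> k by move=> kk2; rewrite kk2 in ck2.
  have abs_half (u : R) : `|u| = 1 / 2 -> u = 1 / 2 \/ u = - (1 / 2).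
    by case: (ger0P u) => _ uh; [left|right]; lra.
  rewrite /= /RII_after /=; case=> -[-> ->] /= [ss' h];
    apply: abs_half.
    by rewrite ss'; lra.
  by lra.
move=> s_half; have sE : `|s| = 1 / 2 by case: s_half => ->; rewrite ?normrN.
split; first by rewrite sE; lra.
exists k', s; split=> //; first by rewrite sE; lra.
by rewrite /= /RII_after /=; case: (perm2_vals pi kk') => -[-> ->] /=;
  rewrite sE subrr.
Qed.

Lemma RIII_after_foreign r (c : 'I_3 -> 'I_r) (pi : 'S_3) k :
  foreign_crossings c (RIII_after (R := R) \o pi) k =
  -%R @` foreign_crossings c (RIII_before (R := R) \o pi) k.
Proof.
apply/seteqP; split=> [s [s1 [k' [s' [s'1 ckk' /=]]]]|_ [s + <-]].
  rewrite !RIII_afterE => /oppr_inj eqT; exists (- s); last by rewrite opprK.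
  by split; [rewrite normrN|exists k', (- s'); rewrite normrN].
case=> s1 [k' [s' [s'1 ckk' /= eqT]]]; split; first by rewrite normrN.
exists k', (- s'); split; rewrite ?normrN//=.
by rewrite !RIII_afterE !opprK eqT.
Qed.

End Moves.

Lemma OU_number_elementary (R : realType) (X : surface) (r : nat)
    (m : move_type r) (E E' : diagram R X r) i : ~ RIII_alpha m ->
  elementary_move m E E' -> OU_number E' i = OU_number E i.
Proof.
case: m => [_ [c]|_ [c [pi]]|c not_alpha [pi]] /=.
- apply: OU_number_replacement.
  + exact: RI_before_square.
  + exact: RI_after_square.
  + have foreign0 T k : foreign_crossings (R := R) c T k = set0.
      by apply/seteqP; split=> // s [_ [k' [? [_]]]]; rewrite !ord1.
    by move=> k _; rewrite !foreign0.
  + by move=> k1 k k2; rewrite !ord1.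
- apply: OU_number_replacement.
  + by move=> k s; exact: RII_before_square.
  + by move=> k s; exact: RII_after_square.
  + move=> k _; rewrite RII_before_foreign fset_set0.
    have [[k' ckk']|same] := pselect (exists k', c k' <> c k).
      rewrite (RII_after_foreign _ _ ckk') fset_setU// !fset_set1 cardfs2.
      by have -> : 1 / 2 != - (1 / 2) :> R by apply/eqP; lra.
    suff -> : foreign_crossings c (RII_after (R := R) \o pi) k = set0.
      by rewrite fset_set0.
    apply/seteqP; split=> // s [_ [k' [? [_ ckk']]]].
    by case: same; exists k'.
  + by move=> [[|[|//]] ?] [[|[|//]] ?] [[|[|//]] ?].
- apply: OU_number_replacement.
  + by move=> k s; exact: RIII_before_square.
  + by move=> k s; exact: RIII_after_square.
  + by move=> k fin; rewrite RIII_after_foreign fset_set_image// card_imfset//.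
  + move=> k1 k k2 between.
    (* Only the middle strand can lie between two others. *)
    have [k1E kE k2E] : [/\ k1 = 0%N :> nat, k = 1%N :> nat & k2 = 2%N :> nat].
      by have := ltn_ord k2; split; lia.
    have -> : k1 = upper by apply/val_inj; rewrite /upper /= inordK.
    have -> : k = middle by apply/val_inj; rewrite /middle /= inordK.
    have -> : k2 = lower by apply/val_inj; rewrite /lower /= inordK.
    have [um|um] := pselect (c upper = c middle); first by left.
    by right; apply: contrapT => ml; apply: not_alpha.
Qed.

Theorem theorem1 (R : realType) (X : surface) (r : nat)
    (D D' : diagram R X r) (m : move_type r)
    (hmove : reidemeister_move m D D') (hm : ~ RIII_alpha m) (i : 'I_r) :
  OU_number D' i = OU_number D i.
Proof.
case: hmove => E [E' [DE D'E' move_EE']].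
rewrite -(OU_number_same_diagram i DE) -(OU_number_same_diagram i D'E').
by case: move_EE' => /(OU_number_elementary i hm) ->.
Qed.
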